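(* Let $X$ be an mm-space and let $\boldsymbol{\alpha}=(\alpha_1,\ldots,\alpha_n)\in(0,\infty)^n$ with $n\in\mathbb{N}\cup\{\infty\}$, where $(0,\infty)^\infty=(0,\infty)^{\mathbb{N}}$. Then the following are equivalent. (1) There exist an mm-space $Y$ with $Y\succ X$ and distinct points $\{y_i\}_{i=1}^n\subset Y$ such that $\mu_Y(\{y_i\})\ge\alpha_i$ for any $i\in\mathbb{N}\cap[1,n]$. (2) There exists a family $\{x_i\}_{i=1}^n\subset X$ (of not necessarily distinct points) such that $$\mu_X(\{x_i\mid i\in I\})\ge\sum_{i\in I}\alpha_i$$ for any $I\subset\mathbb{N}\cap[1,n]$. (3) $\underline{\operatorname{diam}}(X;\boldsymbol{\alpha})=0$. (4) $\underline{\operatorname{ObsDiam}}(X;\boldsymbol{\alpha})=0$.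
   Context: $\mathbb{N}=\{1,2,\dots\}$. An mm-space is a triple $(X,d_X,\mu_X)$ where $(X,d_X)$ is a complete separable metric space and $\mu_X$ is a Borel probability measure on $X$. For mm-spaces $X,Y$, write $Y\succ X$ ($Y$ dominates $X$) if there is a 1-Lipschitz map $F:Y\to X$ with $F_*\mu_Y=\mu_X$. For an mm-space $X$ and $\boldsymbol{\alpha}\in(0,\infty)^n$, let $D_X(\boldsymbol{\alpha})$ be the set of families $\{A_i\}_{i=1}^n$ of disjoint Borel subsets of $X$ with $\mu_X(A_i)\ge\alpha_i$ for all $i\in\mathbb{N}\cap[1,n]$. Define $$\operatorname{diam}(X;\boldsymbol{\alpha}):=\inf\Big\{\sup_{i\in\mathbb{N}\cap[1,n]}\operatorname{diam}A_i\ \Big|\ \{A_i\}_{i=1}^n\in D_X(\boldsymbol{\alpha})\Big\},$$ with $\operatorname{diam}(X;\boldsymbol{\alpha}):=\infty$ if $D_X(\boldsymbol{\alpha})=\emptyset$; $$\underline{\operatorname{diam}}(X;\boldsymbol{\alpha}):=\inf_{Y\succ X}\operatorname{diam}(Y;\boldsymbol{\alpha}),$$ where $Y$ runs over mm-spaces dominating $X$; and $$\underline{\operatorname{ObsDiam}}(X;\boldsymbol{\alpha}):=\sup\{\underline{\operatorname{diam}}((\mathbb{R},|\cdot|,f_*\mu_X);\boldsymbol{\alpha})\mid f:X\to\mathbb{R}\ \text{is 1-Lipschitz}\}.$$ *)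

(* Defs.v *)
From HB Require Import structures.
From mathcomp Require Import all_boot all_order all_algebra.
From mathcomp Require Import all_classical all_reals all_analysis.
Set Implicit Arguments.
Unset Strict Implicit.
Unset Printing Implicit Defensive.
Import Order.TTheory GRing.Theory Num.Theory numFieldNormedType.Exports.

Local Open Scope classical_set_scope.
Local Open Scope ring_scope.

(* The join with [CompletePseudoMetric] also carries a base point, which is
   harmless for spaces supporting a probability measure. *)
#[short(type="completeMetricType")]
HB.structure Definition CompleteMetric (K : numDomainType) :=
  {T of Metric K T & CompletePseudoMetric K T}.

(* On [R^o], [mdist x y] is `|y - x|. *)
HB.instance Definition _ (R : realType) := Complete.on R^o.

Definition separable (T : topologicalType) : Prop :=
  exists D : set T, countable D /\ dense D.

Notation borelType T := (g_sigma_algebraType (@open T)).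

Record mmSpace (R : realType) := MMSpace {
  mm_carrier :> completeMetricType R ;
  mm_separable : separable mm_carrier ;
  mm_measure : probability (borelType mm_carrier) R
}.

Definition lipschitz1 (R : realType) (T U : metricType R) (f : T -> U) : Prop :=
  forall x y, mdist (f x) (f y) <= mdist x y.

Section pushforward_line.
Variable R : realType.

Lemma lipschitz1_continuous (T U : metricType R) (f : T -> U) :
  lipschitz1 f -> continuous f.
Proof.
move=> lf x A /nbhs_ballP[e /= e0 eA]; apply/nbhs_ballP; exists e => //= y.
by rewrite ballEmdist /= => xy; apply: eA; rewrite ballEmdist /=;
  exact: le_lt_trans (lf x y) xy.
Qed.

Lemma lipschitz1_measurable (T U : completeMetricType R) (f : T -> U) :
  lipschitz1 f -> measurable_fun setT (f : borelType T -> borelType U).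
Proof.
move=> lf.
apply: (@measurability _ _ (borelType T) (borelType U) _ _ (@open U)) => //.
move=> _ [B oB <-].
rewrite setTI; apply: sub_sigma_algebra.
by move/continuousP : (lipschitz1_continuous lf); exact.
Qed.

Definition lipschitz1_mfun (T U : completeMetricType R) (f : T -> U)
    (lf : lipschitz1 f) : {mfun borelType T >-> borelType U} :=
  mfun_Sub (mem_set (lipschitz1_measurable lf)).

Lemma separable_line : separable (R^o : completeMetricType R).
Proof.
exists (range (@ratr R)); split; last exact: dense_rat.
apply: sub_countable; [exact: card_image_le|exact: countableP].
Qed.

(* The mm-space (R, |.|, f_* mu_X). *)
Definition mm_line (X : mmSpace R) (f : X -> R^o) (lf : lipschitz1 f) :
    mmSpace R :=
  MMSpace separable_line (distribution (mm_measure X) (lipschitz1_mfun lf)).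

End pushforward_line.

Definition dominates (R : realType) (Y X : mmSpace R) : Prop :=
  exists2 F : Y -> X, lipschitz1 F &
    forall A : set (borelType X), measurable A ->
      pushforward (mm_measure Y) (F : borelType Y -> borelType X) A =
      mm_measure X A.

(* The positive integers up to [n], where [None] stands for n = oo.  A family
   indexed by this set is a function on [nat] whose values elsewhere are never
   used. *)
Definition idx (n : option nat) : set nat :=
  [set i | (1 <= i)%N /\ (if n is Some m then (i <= m)%N else True)].

Section diameters.
Variables (R : realType).
Local Open Scope ereal_scope.

(* The element 0 only matters for the convention that the empty set has
   diameter 0. *)
Definition diameter (T : metricType R) (A : set T) : \bar R :=
  ereal_sup ([set 0] `|` [set (mdist p.1 p.2)%:E | p in A `*` A]).

Definition admissible (X : mmSpace R) (n : option nat) (alpha : nat -> R)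
    (A : nat -> set X) : Prop :=
  [/\ forall i, idx n i -> measurable (A i : set (borelType X)),
      trivIset (idx n) A &
      forall i, idx n i -> (alpha i)%:E <= mm_measure X (A i)].

Definition diam (X : mmSpace R) (n : option nat) (alpha : nat -> R) : \bar R :=
  ereal_inf [set ereal_sup [set diameter (A i) | i in idx n]
            | A in admissible (X := X) n alpha].

Definition lower_diam (X : mmSpace R) (n : option nat) (alpha : nat -> R) :
    \bar R :=
  ereal_inf [set r | exists2 Y : mmSpace R,
                       dominates Y X & r = diam Y n alpha].

Definition lower_ObsDiam (X : mmSpace R) (n : option nat) (alpha : nat -> R) :
    \bar R :=
  ereal_sup [set r | exists (f : X -> R^o) (lf : lipschitz1 f),
                       r = lower_diam (mm_line lf) n alpha].

End diameters.

(* Main.v *)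
(* (2) implies (1): split the atoms of X along an extra real axis, i.e. take
   Y = X * R with the measure sum_i alpha_i delta_(x_i, i) + rho x delta_0,
   where rho = mu_X - sum_i alpha_i delta_(x_i) is nonnegative by (2).
   (1) => (3) => (4) is immediate.

   (4) implies (2): there are 1-Lipschitz functions f_j : X -> R and e_j > 0
   such that any two distinct points satisfy |f_j x - f_j y| > 2 e_j for all
   large j, namely f_j = 1/2 sum_(k < j) t^k d(u_k, .) with (u_k) dense,
   t = 1/(j+2) and e_j = t^j.  By (4), applied to f_j, there are sets L_(j,i) on
   which f_j oscillates by at most 2 e_j, and the union over i in I of the
   L_(j,i) has measure at least sum_(i in I) alpha_i.  The upper limit in j of
   the L_(j,i) has measure at least alpha_i > 0, so some x_i lies in infinitely
   many of them; pass to those j and repeat with the next i.  Along the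
   resulting indices the upper limit of the L_(j,i) is {x_i}, since no other
   point shares L_(j,i) with x_i for large j, and continuity of the measure
   gives (2) for finite I, hence for all I. *)
Require Import Defs.
From HB Require Import structures.
From mathcomp Require Import all_boot all_order all_algebra.
From mathcomp Require Import all_classical all_reals all_analysis.
From mathcomp Require Import ring lra.
Import Order.TTheory GRing.Theory Num.Theory numFieldNormedType.Exports.
Local Open Scope classical_set_scope.
Local Open Scope ring_scope.
Local Open Scope ereal_scope.

(** * Sums with geometric weights *)

(** The weights sum to at most 2 because [t] is at most 1/2. The induction shifts [c], so it runs
    over all sequences with the same bound. *)
Lemma normr_power_sum_le (R : realFieldType) (t d : R) (c : nat -> R)
    (j : nat) :
  (0 <= t <= 2^-1)%R -> (forall k, `|c k| <= d)%R ->
  (`|\sum_(k < j) t ^+ k * c k| <= 2 * d)%R.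
Proof.
move=> /andP[t0 t2]; elim: j c => [|j IH] c cd.
  by rewrite big_ord0 normr0 mulr_ge0// (le_trans _ (cd 0%N)).
rewrite big_ord_recl expr0 mul1r.
under eq_bigr do rewrite lift0 exprS -mulrA.
rewrite -mulr_sumr (le_trans (ler_normD _ _))//.
have -> : (2 * d = d + 2^-1 * (2 * d))%R by field.
by rewrite lerD// normrM (ger0_norm t0) ler_pM//; exact: (IH (fun k => c k.+1)).
Qed.

(* For small [t] the first nonzero term dominates the sum; [t = (j.+2)^-1]
   makes this work for all large [j] simultaneously. *)
Lemma normr_power_sum_gt (R : archiRealFieldType) (d : R) (c : nat -> R) :
  (forall k, `|c k| <= d)%R -> (exists k, c k != 0%R) ->
  exists N, forall j, (N <= j)%N ->
    (4 * j.+2%:R^-1 ^+ j < `|\sum_(k < j) j.+2%:R^-1 ^+ k * c k|)%R.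
Proof.
move=> cd ex; pose m := ex_minn ex.
have [cm cmin] : c m != 0%R /\ forall k, (k < m)%N -> c k = 0%R.
  rewrite /m; case: ex_minnP => {}m cm mmin; split=> // k km.
  by apply/eqP; apply: contraTT km => /mmin; rewrite -leqNgt.
have d0 : (0 <= d)%R by exact: le_trans (cd 0%N).
have cm0 : (0 < `|c m|)%R by rewrite normr_gt0.
(* The first bound puts the term [m] into the sum; the second makes [j.+2%:R^-1 * (4 + 2 * d)]
   smaller than the absolute value of [c m]. *)
exists (maxn m.+1 (Num.bound ((4 + 2 * d) / `|c m|))) => j.
rewrite geq_max => /andP[mj]; set B := Num.bound _ => Bj.
set t : R := j.+2%:R^-1%R.
have t0 : (0 < t)%R by rewrite invr_gt0 ltr0n.
have t2 : (t <= 2^-1)%R by rewrite lef_pV2 ?posrE ?ltr0n// ler_nat.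
have tc : (t * (4 + 2 * d) < `|c m|)%R.
  rewrite /t mulrC ltr_pdivrMr ?ltr0n// [ltRHS]mulrC -ltr_pdivrMr//.
  have : ((4 + 2 * d) / `|c m| < B%:R)%R.
    by rewrite archi_boundP// divr_ge0// addr_ge0// mulr_ge0.
  by move=> h; apply: (lt_le_trans h); rewrite ler_nat (leq_trans Bj)// !leqW.
(* With [j = m.+1 + i] the sum equals [t ^+ m * (c m + t * S)], where [S] is a sum of the same kind,
   bounded by [2 * d]. *)
clearbody t; have /subnKC <- := mj; move: {mj Bj}(j - m.+1)%N => i.
rewrite addSnnS big_split_ord/= big1 ?add0r; last first.
  by move=> k _; rewrite cmin// mulr0.
rewrite big_ord_recl/= addn0.
under eq_bigr do rewrite /bump/= addnA addn1 exprS exprD -!mulrA mulrCA.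
rewrite -!mulr_sumr.
set S := (\sum_(k < i) _)%R.
have Sd : (`|S| <= 2 * d)%R.
  apply: (@normr_power_sum_le _ _ _ (fun k => c (m.+1 + k)%N)) => //.
  by rewrite (ltW t0).
rewrite exprD exprS mulrA.
rewrite (_ : t ^+ m * c m + _ = t ^+ m * (c m + t * S))%R; last by ring.
rewrite normrM ger0_norm; last by rewrite exprn_ge0// ltW.
have tS : (`|c m| - t * (2 * d) <= `|c m + t * S|)%R.
  rewrite (le_trans _ (lerB_normD _ _))// lerB// normrM (ger0_norm (ltW t0)).
  by rewrite ler_wpM2l// ltW.
have ti : (t ^+ i <= 1)%R by rewrite exprn_ile1 ?ltW//; lra.
have tm : (0 < t ^+ m)%R by rewrite exprn_gt0.
have {}ti : (4 * (t * t ^+ i) <= 4 * t)%R by nra.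
have : (4 * (t * t ^+ i) < `|c m + t * S|)%R by lra.
by move: tm; nra.
Qed.

(** * Lipschitz functions that separate points *)

Lemma mdist_lineE (R : realType) (x y : R^o) : mdist x y = `|y - x|%R.
Proof. by []. Qed.

Lemma lipschitz1_mdist (R : realType) (T : metricType R) (p : T) :
  lipschitz1 (mdist p : T -> R^o).
Proof.
move=> x y; rewrite mdist_lineE ler_norml; apply/andP; split.
  by rewrite lerNl opprB lerBlDr addrC (metric_sym x y) (metric_triangle p y x).
by rewrite lerBlDr addrC (metric_triangle p x y).
Qed.

Lemma closed_measurable_borel (T : ptopologicalType) (A : set T) :
  closed A -> measurable (A : set (borelType T)).
Proof.
rewrite -openC => oA; rewrite -[X in measurable X]setCK.
apply: measurableC; apply: sub_sigma_algebra; exact: oA.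
Qed.

Lemma measurable_le_mdist (R : realType) (T : completeMetricType R) (p : T)
    (e : R) :
  measurable ([set x | mdist p x <= e]%R : set (borelType T)).
Proof.
apply: closed_measurable_borel.
apply: (@preimage_closed T R^o (mdist p) [set r | r <= e]%R).
  by move=> x _; exact/lipschitz1_continuous/lipschitz1_mdist.
exact: closed_le.
Qed.

Lemma measurable_set1_borel (R : realType) (T : completeMetricType R) (x : T) :
  measurable ([set x] : set (borelType T)).
Proof.
apply: closed_measurable_borel.
exact/accessible_closed_set1/hausdorff_accessible/metric_hausdorff.
Qed.

Lemma eventually_separating_lipschitz (R : realType)
    (T : completeMetricType R) :
  separable T -> exists (f : nat -> T -> R^o) (e : nat -> R),
  [/\ forall j, lipschitz1 (f j), forall j, (0 < e j)%R &
      forall x y, x <> y ->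
        exists N, forall j, (N <= j)%N -> (2 * e j < mdist (f j x) (f j y))%R].
Proof.
move=> [D [cD dD]].
have /pcard_surjP[u Du] : (D #<= [set: nat])%card := cD.
(* The factor 1/2 cancels the bound 2 on the total weight, which gives Lipschitz constant 1, and it
   turns the gap [4 * j.+2%:R^-1 ^+ j] into [2 * e j]. *)
exists (fun j x => 2^-1 * \sum_(k < j) j.+2%:R^-1 ^+ k * mdist (u k) x)%R.
exists (fun j => j.+2%:R^-1 ^+ j)%R.
have fB j x y :
    mdist ((2^-1 * \sum_(k < j) j.+2%:R^-1 ^+ k * mdist (u k) x)%R : R^o)
      (2^-1 * \sum_(k < j) j.+2%:R^-1 ^+ k * mdist (u k) y)%R =
    (2^-1 * `|\sum_(k < j)
      j.+2%:R^-1 ^+ k * (mdist (u k) y - mdist (u k) x)|)%R.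
  rewrite mdist_lineE -mulrBr normrM ger0_norm// -sumrB; congr (_ * `| _ |)%R.
  by apply: eq_bigr => k _; rewrite mulrBr.
split=> [j x y|j|x y xy].
- rewrite fB ler_pdivrMl//.
  apply: (@normr_power_sum_le _ _ _
    (fun k => (mdist (u k) y - mdist (u k) x)%R)).
    by rewrite invr_ge0 ler0n lef_pV2 ?posrE ?ltr0n// ler_nat.
  by move=> k; exact: lipschitz1_mdist.
- by rewrite exprn_gt0// invr_gt0 ltr0n.
have [||N HN] := @normr_power_sum_gt R (mdist x y)
    (fun k => mdist (u k) y - mdist (u k) x)%R.
- by move=> k; exact: lipschitz1_mdist.
(* A dense point closer to [x] than half of [mdist x y] cannot be equidistant from [x] and [y]. *)
- have xy0 : (0 < mdist x y / 2)%R.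
    by rewrite divr_gt0// mdist_gt0; exact/eqP.
  have [||z [/interior_subset bz /Du]] := dD (ball x (mdist x y / 2)%R)°.
  + by exists x; exact: nbhsx_ballx.
  + exact: open_interior.
  move=> [k _ kz]; exists k; rewrite kz; apply/eqP => /eqP.
  rewrite subr_eq0 => /eqP zyx; move: bz; rewrite ballEmdist/= => bz.
  have := metric_triangle x z y; rewrite zyx (metric_sym z x); lra.
- exists N => j /HN; rewrite fB; lra.
Qed.

(** * From small diameters to atoms *)

(** [C i] is a closed ball of radius [e] around the image of a point of [A i], where the [A i] are
    disjoint sets of diameter below [e] in a dominating space. It contains the whole image of [A i]
    and, unlike that image, is always Borel. *)
Lemma lower_diam_lt_cover (R : realType) (Z : mmSpace R) (n : option nat)
    (alpha : nat -> R) (e : R) :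
  (forall i, idx n i -> (0 < alpha i)%R) -> lower_diam Z n alpha < e%:E ->
  exists C : nat -> set Z,
  [/\ forall i, measurable (C i : set (borelType Z)),
      forall i x y, C i x -> C i y -> (mdist x y <= 2 * e)%R &
      forall I : set nat, I `<=` idx n ->
        \esum_(i in I) (alpha i)%:E <= mm_measure Z (\bigcup_(i in I) C i)].
Proof.
move=> a0 /ereal_inf_lt[_ [Y [G Glip Gmu] ->]].
move=> /ereal_inf_lt[_ [A [mA tA aA] <-] Ae].
have /choice[p Ap] i : exists p, idx n i -> A i p.
  have [ni|ni] := pselect (idx n i); last by exists point.
  have [/set0P[p Aip]|A0] := boolP (A i != set0); first by exists p.
  move: A0 => /negPn/eqP A0; have := aA _ ni.
  by rewrite A0 measure0 lee_fin leNgt a0.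
exists (fun i => [set z | mdist (G (p i)) z <= e]%R); split.
- by move=> i; exact: measurable_le_mdist.
- move=> i x y /= px py; rewrite (le_trans (metric_triangle _ (G (p i)) _))//.
  rewrite (metric_sym x); lra.
move=> I In; have mI i : I i -> measurable (A i : set (borelType Y)).
  by move=> /In; exact: mA.
have mC : measurable
    (\bigcup_(i in I) [set z | (mdist (G (p i)) z <= e)%R] : set (borelType Z)).
  by apply: bigcup_measurable => i _; exact: measurable_le_mdist.
apply: (@le_trans _ _ (mm_measure Y (\bigcup_(i in I) A i))).
  rewrite measure_bigcup//; last by move=> i j Ii Ij; apply: tA; exact: In.
  rewrite nneseries_esum// set_mem_set.
  by apply: le_esum => i Ii; exact/aA/In.
rewrite -Gmu// /pushforward; apply: le_measure; rewrite ?inE.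
- exact: bigcup_measurable.
- rewrite -[X in measurable X]setTI.
  exact: (lipschitz1_measurable Glip).
move=> y [i Ii Aiy]; exists i => //=.
rewrite (le_trans (Glip _ _))// -lee_fin (le_trans _ (ltW Ae))//.
apply: (@le_trans _ _ (diameter (A i))); last first.
  by apply: ereal_sup_ubound; exists i => //; exact: In.
apply: ereal_sup_ubound; right; exists (p i, y) => //.
by split => //=; exact/Ap/In.
Qed.

(** A reverse Fatou inequality for sets: [S] contains the upper limit of the [F j] along [J], and
    finiteness of [mu] gives continuity from above. *)
Lemma measure_frequently_ge (d : measure_display) (T : measurableType d)
    (R : realType) (mu : {finite_measure set T -> \bar R}) (J : set nat)
    (F : nat -> set T) (S : set T) (a : \bar R) :
  (forall N, exists2 j, (N <= j)%N & J j) ->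
  (forall j, measurable (F j)) -> (forall j, J j -> a <= mu (F j)) ->
  measurable S ->
  (forall x, (forall N, exists2 j, (N <= j)%N & J j /\ F j x) -> S x) ->
  a <= mu S.
Proof.
(* Emptying the sets off [J] turns the upper limit along [J] into one along all indices. *)
move=> Joo mF aF mS FS; pose G j := if j \in J then F j else set0.
have mG j : measurable (G j) by rewrite /G; case: ifP.
have mUG N : measurable (\bigcup_(j in [set k | (N <= k)%N]) G j).
  by apply: bigcup_measurable => j _; exact: mG.
apply: (@le_trans _ _ (mu (lim_sup_set G))); last first.
  apply: le_measure; rewrite ?inE//.
    by apply: bigcap_measurable => //; exists 0%N.
  move=> x Gx; apply: FS => N; have [j /= Nj] := Gx N Logic.I.
  by rewrite /G; case: ifPn => // /set_mem Jj Fjx; exists j.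
have Gfin : mu (\bigcup_(k in [set k | (0 <= k)%N]) G k) < +oo.
  rewrite (le_lt_trans (le_measure _ _ _ (@subsetT _ _))) ?inE//.
  by rewrite ltey_eq fin_num_measure.
apply: (cvge_ge _ (lim_sup_set_cvg mu G mG Gfin)).
near=> N; have [j Nj Jj] := Joo N.
apply: (le_trans (aF _ Jj)); apply: le_measure; rewrite ?inE//.
by move=> x Fx; exists j => //; rewrite /G ifT// inE.
Unshelve. all: by end_near. Qed.

(** A decreasing chain of infinite index sets [J i] replaces a diagonal sequence: a finite set of
    indices below [m] only needs [J m]. *)
Lemma limit_atoms (d : measure_display) (T : measurableType d)
    (R : realType) (mu : {finite_measure set T -> \bar R}) (x0 : T)
    (D : set nat) (L : nat -> nat -> set T) (alpha : nat -> R) :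
  (forall x, measurable [set x : T]) ->
  (forall i, D i -> (0 < alpha i)%R) ->
  (forall j i, measurable (L j i)) ->
  (forall j (I : set nat), I `<=` D ->
    \esum_(i in I) (alpha i)%:E <= mu (\bigcup_(i in I) L j i)) ->
  (forall x y, x <> y ->
    exists N, forall j i, (N <= j)%N -> L j i x -> L j i y -> False) ->
  exists x : nat -> T, forall I : set nat, I `<=` D ->
    \esum_(i in I) (alpha i)%:E <= mu [set x i | i in I].
Proof.
move=> m1 a0 mL aL Lsep.
pose cofinal (J : set nat) := forall N, exists2 j, (N <= j)%N & J j.
have /choice[g gP] : forall iJ : nat * set nat, exists pJ : T * set nat,
    cofinal iJ.2 -> [/\ cofinal pJ.2, pJ.2 `<=` iJ.2 &
      D iJ.1 -> forall j, pJ.2 j -> L j iJ.1 pJ.1].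
  move=> [i J] /=; have [Joo|] := pselect (cofinal J); last by exists (x0, J).
  have [Di|Di] := pselect (D i); last by exists (x0, J) => _; split.
  (* Otherwise the upper limit of the [L j i] along [J] is empty, yet of measure at least
     [alpha i]. *)
  have [p pJ] : exists p, cofinal [set j | J j /\ L j i p].
    apply: contrapT => /forallNP noP.
    suff : (alpha i)%:E <= mu set0 by rewrite measure0 lee_fin leNgt a0.
    apply: (@measure_frequently_ge _ _ _ mu J (L ^~ i) set0 _ Joo) => // j _.
    have := aL j [set i]; rewrite esum_set1 ?lee_fin ?(ltW (a0 _ Di))//.
    by rewrite bigcup_set1; apply=> _ ->.
  by exists (p, [set j | J j /\ L j i p]) => _; split => //= [j []|_ j []].
(* If [D i] holds, every [j] in [J i.+1] lies in [J i] and has [x i] in [L j i]. *)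
pose fix J i := if i is k.+1 then (g (k, J k)).2 else [set: nat].
pose x i := (g (i, J i)).1.
have Joo i : cofinal (J i).
  elim: i => [|i IH] /=; first by move=> N; exists N.
  by have [] := gP (i, J i) IH.
have Jle i k : (i <= k)%N -> J k `<=` J i.
  move=> /subnK <-; elim: (k - i)%N => // l IH j.
  have [_ gJ _] := gP (l + i, J (l + i)%N)%N (Joo _).
  by rewrite addSn /= => /gJ/IH.
have Lx i j : D i -> J i.+1 j -> L j i (x i).
  by move=> Di; have [_ _ /(_ Di)] := gP (i, J i) (Joo i); exact.
(* The sum over [I] is the supremum of the sums over its finite subsets [K]. *)
exists x => I ID; apply: ge_ereal_sup => _ [K [finK KI] <-].
have KD : K `<=` D := subset_trans KI ID.
have mxK : measurable [set x i | i in K].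
  rewrite -bigcup_imset1; apply: fin_bigcup_measurable => // i _; exact: m1.
have mxI : measurable [set x i | i in I].
  by rewrite -bigcup_imset1; apply: bigcup_measurable => i _; exact: m1.
apply: (@le_trans _ _ (mu [set x i | i in K])); last first.
  by apply: le_measure; rewrite ?inE//; exact: image_subset.
rewrite -esum_fset//; last by move=> i /set_mem /KD /a0 /ltW; rewrite lee_fin.
have [m Km] : exists m, forall i, K i -> (i < m)%N.
  have /finite_seqP[m mK] := finK.
  exists (\max_(i <- m) i).+1 => i; rewrite mK /= ltnS => im.
  exact: leq_bigmax_seq.
apply: (@measure_frequently_ge _ _ _ mu (J m)
  (fun j => \bigcup_(i in K) L j i)) => //.
- exact: Joo.
- by move=> j; apply: fin_bigcup_measurable.
- by move=> j _; exact: aL.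
(* A limit point [y] other than every [x i] with [i] in [K] would share some [L j i] with [x i] for
   a [j] beyond all the thresholds [N i]. *)
move=> y yL; apply: contrapT => yx.
have /choice[N NP] i : exists N, K i -> forall j, (N <= j)%N -> L j i (x i) ->
    L j i y -> False.
  have [Ki|Ki] := pselect (K i); last by exists 0%N.
  have [N NP] : exists N, forall j i', (N <= j)%N ->
      L j i' (x i) -> L j i' y -> False.
    by apply: Lsep => xy; apply: yx; exists i.
  by exists N => _ j; exact: NP.
have [j jN [Jj [i Ki Ly]]] := yL (\max_(i < m) N i)%N.
apply: (NP i Ki j) => //; last first.
  by apply: Lx; [exact: KD|exact: (Jle _ m (Km _ Ki))].
by apply: leq_trans jN; exact: (leq_bigmax (Ordinal (Km _ Ki))).
Qed.

(** The covers of the line are pulled back along [f j]. On a pulled-back set [f j] varies by at most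
    [2 * e j], so for large [j] the set cannot contain two given distinct points. *)
Lemma lower_ObsDiam0_atoms (R : realType) (X : mmSpace R) (n : option nat)
    (alpha : nat -> R) :
  (forall i, idx n i -> (0 < alpha i)%R) -> lower_ObsDiam X n alpha <= 0 ->
  exists x : nat -> X, forall I : set nat, I `<=` idx n ->
    \esum_(i in I) (alpha i)%:E <= mm_measure X [set x i | i in I].
Proof.
move=> a0 obs.
have [f [e [flip e0 fsep]]] :=
  eventually_separating_lipschitz _ _ (mm_separable X).
have /choice[C CP] j : exists C : nat -> set R^o,
    [/\ forall i, measurable (C i : set (borelType R^o)),
      forall i x y, C i x -> C i y -> (mdist x y <= 2 * e j)%R &
      forall I : set nat, I `<=` idx n ->
        \esum_(i in I) (alpha i)%:E <=
        mm_measure (mm_line (flip j)) (\bigcup_(i in I) C i)].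
  apply: (@lower_diam_lt_cover _ (mm_line (flip j))) => //.
  rewrite (@le_lt_trans _ _ 0) ?lte_fin// (le_trans _ obs)//.
  by apply: ereal_sup_ubound; exists (f j), (flip j).
apply: (@limit_atoms _ (borelType X) R (mm_measure X) point (idx n)
  (fun j i => f j @^-1` C j i)) => //.
- exact: measurable_set1_borel.
- move=> j i; have [mC _ _] := CP j.
  by rewrite -[X in measurable X]setTI; apply: lipschitz1_measurable.
- by move=> j I In; have [_ _ /(_ _ In)] := CP j; rewrite -preimage_bigcup.
move=> x y /fsep[N NP]; exists N => j i /NP + Cx Cy.
by have [_ /(_ _ _ _ Cx Cy) + _] := CP j; rewrite leNgt => /negP.
Qed.

(** * Products of complete separable metric spaces *)

Section product_metric.
Variables (R : realFieldType) (T U : metricType R).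

(** The maximum metric has products of balls as its balls, and makes projections and slice
    inclusions 1-Lipschitz. *)
Let dist (p q : T * U) : R := Num.max (mdist p.1 q.1) (mdist p.2 q.2).

Let dist_ge0 p q : (0 <= dist p q)%R.
Proof. by rewrite /dist le_max mdist_ge0. Qed.

Let dist_positivity p q : dist p q = 0%R -> p = q.
Proof.
case: p q => [p1 p2] [q1 q2] d0; have := lexx (dist (p1, p2) (q1, q2)).
rewrite [leRHS]d0 /dist/= ge_max => /andP[d1 d2].
congr (_, _); apply: mdist_positivity; apply/eqP;
  by rewrite eq_le ?d1 ?d2 mdist_ge0.
Qed.

Let ball_dist p (d : R) : ball p d = [set q | (dist p q < d)%R].
Proof.
apply/seteqP; split=> q; rewrite /ball/= /prod_ball !ballEmdist /dist /= gt_max.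
  by case=> -> ->.
by move=> /andP[].
Qed.

HB.instance Definition _ := PseudoMetric_isMetric.Build R (T * U)%type
  dist_ge0 dist_positivity ball_dist.

Lemma mdist_prodE (p q : T * U) :
  mdist p q = Num.max (mdist p.1 q.1) (mdist p.2 q.2).
Proof. by []. Qed.

End product_metric.

HB.instance Definition _ (T U : puniformType) := Pointed.on (T * U)%type.

Lemma prod_cauchy_cvg (R : numFieldType) (T U : completePseudoMetricType R)
    (F : set_system (T * U)) : ProperFilter F -> cauchy F -> cvg F.
Proof.
move=> FF /cauchyP Fc.
have ballP (p q : T * U) (e : R) :
    ball p e q -> ball p.1 e q.1 /\ ball p.2 e q.2.
  by [].
have F1 : cvg (fst @ F).
  apply: cauchy_cvg; apply/cauchyP => e e0; have [x Fx] := Fc e e0.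
  by exists x.1; apply: (@filterS _ F _ (ball x e)) => // y /ballP[].
have F2 : cvg (snd @ F).
  apply: cauchy_cvg; apply/cauchyP => e e0; have [x Fx] := Fc e e0.
  by exists x.2; apply: (@filterS _ F _ (ball x e)) => // y /ballP[].
apply/cvg_ex; exists (lim (fst @ F), lim (snd @ F)).
apply: cvg_trans (cvg_pair F1 F2) => A.
by move=> FA; apply: (@filterS _ F _ [set p | A (p.1, p.2)]) => // -[a b].
Qed.

HB.instance Definition _ (R : numFieldType)
    (T U : completePseudoMetricType R) :=
  Uniform_isComplete.Build (T * U)%type (@prod_cauchy_cvg R T U).

Lemma separable_prod (T U : topologicalType) :
  separable T -> separable U -> separable (T * U)%type.
Proof.
move=> [D [cD dD]] [E [cE dE]]; exists (D `*` E).
split; first exact: countableX.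
move=> O [p Op] oO; have : nbhs p O by exact: open_nbhs_nbhs.
move=> [[A B]] /= [pA pB] ABO.
have [||x [/interior_subset Ax Dx]] := dD A°.
- by exists p.1.
- exact: open_interior.
have [||y [/interior_subset By Ey]] := dE B°.
- by exists p.2.
- exact: open_interior.
by exists (x, y); split => //; exact: ABO.
Qed.

HB.instance Definition _ (R : realType) (T U : completeMetricType R) :=
  Complete.on (T * U)%type.

(** * Splitting a measure into atoms and a remainder *)

Lemma measure_complement (d : measure_display) (T : measurableType d)
    (R : realType) (mu sigma : {measure set T -> \bar R}) :
  mu setT < +oo -> (forall A, measurable A -> sigma A <= mu A) ->
  exists rho : {measure set T -> \bar R},
    forall A, measurable A -> rho A + sigma A = mu A.
Proof.
(* The truncation secures nonnegativity on nonmeasurable sets as well; on measurable ones it changes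
   nothing. *)
move=> muT le_smu; pose r A := maxe 0 (mu A - sigma A).
have muoo A : measurable A -> mu A \is a fin_num.
  move=> mA; rewrite ge0_fin_numE// (le_lt_trans _ muT)//.
  by apply: le_measure; rewrite ?inE.
have soo A : measurable A -> sigma A \is a fin_num.
  move=> mA; rewrite ge0_fin_numE// (le_lt_trans (le_smu _ mA))//.
  by rewrite -ge0_fin_numE// muoo.
have rE A : measurable A -> r A = mu A - sigma A.
  by move=> mA; rewrite /r max_r// sube_ge0 ?le_smu// soo.
have r0 : r set0 = 0 by rewrite rE// !measure0 subee.
have r_ge0 A : 0 <= r A by rewrite /r le_max lexx.
have r_add : semi_sigma_additive r.
  move=> F mF tF mUF; rewrite rE//.
  rewrite (_ : (fun n => _) = (fun n => \sum_(0 <= i < n) mu (F i)) \-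
      (fun n => \sum_(0 <= i < n) sigma (F i))).
    apply: cvgeB; [|exact: measure_semi_sigma_additive..].
    by rewrite fin_num_adde_defl// fin_numN soo.
  apply/funext => n /=; rewrite -fin_num_sumeN; last by move=> i _; exact: soo.
  by rewrite -big_split; apply: eq_bigr => i _; rewrite rE.
pose rho : {measure set T -> \bar R} :=
  HB.pack r (isMeasure.Build _ _ _ r r0 r_ge0 r_add).
exists rho => A mA /=; rewrite rE// subeK//; exact: soo.
Qed.

Lemma measure_of_atoms (d : measure_display) (T : measurableType d)
    (R : realType) (D : set nat) (x : nat -> T) (alpha : nat -> R) :
  (forall i, D i -> (0 <= alpha i)%R) ->
  exists sigma : {measure set T -> \bar R},
    forall A, sigma A = \esum_(i in D `&` x @^-1` A) (alpha i)%:E.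
Proof.
move=> a0.
(* The absolute value makes the weight nonnegative at every index and keeps [alpha i] on [D]. *)
pose w (i : nat) : {nonneg R} :=
  NngNum (normr_ge0 (if i \in D then alpha i else 0%R)).
exists (mseries (fun i => mscale (w i) \d_(x i)) 0) => A.
rewrite [LHS]/= /mseries nneseries_esumT; last by move=> i; exact: measure_ge0.
rewrite [RHS]esum_mkcond; apply: eq_esum => i _.
rewrite /= /mscale /w /= diracE in_setI; case: ifPn => [/set_mem Di|_] /=.
  rewrite ger0_norm ?a0// (_ : (x i \in A) = (i \in x @^-1` A))//.
  by case: ifPn; rewrite (mule1, mule0).
by rewrite normr0 mul0e.
Qed.

Lemma measure_pushforward (d1 d2 : measure_display) (T1 : measurableType d1)
    (T2 : measurableType d2) (R : realType) (mu : {measure set T1 -> \bar R})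
    (f : {mfun T1 >-> T2}) :
  exists nu : {measure set T2 -> \bar R}, forall A, nu A = mu (f @^-1` A).
Proof.
by exists (pushforward mu f).
Unshelve. exact: measurable_funPT.
Qed.

Lemma atoms_dominating (R : realType) (X : mmSpace R) (n : option nat)
    (alpha : nat -> R) (x : nat -> X) :
  (forall i, idx n i -> (0 < alpha i)%R) ->
  (forall I : set nat, I `<=` idx n ->
    \esum_(i in I) (alpha i)%:E <= mm_measure X [set x i | i in I]) ->
  exists2 Y : mmSpace R, dominates Y X &
    exists2 y : nat -> Y, set_inj (idx n) y &
      forall i, idx n i -> (alpha i)%:E <= mm_measure Y [set y i].
Proof.
move=> a0 ax; have age0 i : idx n i -> (0 <= alpha i)%R by move=> /a0/ltW.
pose Y : completeMetricType R := (X * R^o)%type.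
(* The height [i] keeps the points distinct even where [x] repeats. *)
pose y i : Y := (x i, i%:R%R).
have [sX sXE] := @measure_of_atoms _ (borelType X) _ _ x _ age0.
have [sY sYE] := @measure_of_atoms _ (borelType Y) _ _ y _ age0.
have m1 := @measurable_set1_borel R.
(* The hypothesis is applied to the indices [i] with [x i] in [A]. *)
have sX_le A : measurable (A : set (borelType X)) -> sX A <= mm_measure X A.
  move=> mA; rewrite sXE (le_trans (ax _ (@subIsetl _ _ _)))//.
  apply: le_measure; rewrite ?inE//; last by move=> _ [i [_ Axi] <-].
  by rewrite -bigcup_imset1; apply: bigcup_measurable => i _; exact: m1.
have muT : mm_measure X setT < +oo by rewrite probability_setT ltry.
have [rho rhoE] := measure_complement _ _ _ _ _ muT sX_le.
have ilip : lipschitz1 ((fun p => (p, 0%R)) : X -> Y).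
  by move=> p q; rewrite mdist_prodE/= mdistxx ge_max lexx mdist_ge0.
have [r rE] := @measure_pushforward _ _ _ _ _ rho (lipschitz1_mfun ilip).
have Flip : lipschitz1 (fst : Y -> X).
  by move=> p q; rewrite mdist_prodE le_max lexx.
have nuE A : measurable (A : set (borelType X)) ->
    measure_add r sY (fst @^-1` A) = mm_measure X A.
  by move=> mA; rewrite measure_addE rE sYE -rhoE// sXE.
have nuT : measure_add r sY [set: borelType Y] = 1.
  by rewrite -(preimage_setT fst) nuE// probability_setT.
pose nu : probability (borelType Y) R :=
  HB.pack (Measure.sort (measure_add r sY))
    (Measure_isProbability.Build _ _ _ (measure_add r sY) nuT).
exists (MMSpace (separable_prod _ _ (mm_separable X) (@separable_line R)) nu).
  by exists fst.
have yinj i j : y i = y j -> i = j by case=> _ /eqP; rewrite eqr_nat => /eqP.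
exists y => [i j _ _ /yinj //|i ni].
rewrite [leRHS]measure_addE (le_trans _ (leeDr _ _))// sYE.
rewrite (_ : _ `&` _ = [set i]) ?esum_set1 ?lee_fin ?age0//.
by apply/seteqP; split=> [j [_ /yinj]//|_ ->].
Qed.

(** * Domination and bounds for the lower diameter *)

Lemma dominates_trans (R : realType) (Z Y X : mmSpace R) :
  dominates Z Y -> dominates Y X -> dominates Z X.
Proof.
move=> [G Glip Gmu] [F Flip Fmu]; exists (F \o G) => [x y|A mA].
  exact: le_trans (Flip _ _) (Glip _ _).
rewrite -Fmu// /pushforward -Gmu//.
by rewrite -[X in measurable X]setTI; apply: (lipschitz1_measurable Flip).
Qed.

Lemma dominates_line (R : realType) (X : mmSpace R) (f : X -> R^o)
    (lf : lipschitz1 f) : dominates X (mm_line lf).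
Proof. by exists f. Qed.

Lemma lower_diam_le (R : realType) (Y X : mmSpace R) (n : option nat)
    (alpha : nat -> R) :
  dominates Y X -> lower_diam X n alpha <= lower_diam Y n alpha.
Proof.
move=> YX; apply: ereal_inf_le_tmp => _ [Z ZY ->]; exists Z => //.
exact: dominates_trans ZY YX.
Qed.

Lemma diameter_ge0 (R : realType) (T : metricType R) (A : set T) :
  0 <= diameter A.
Proof. by apply: ereal_sup_ubound; left. Qed.

Lemma lower_diam_ge0 (R : realType) (X : mmSpace R) (n : option nat)
    (alpha : nat -> R) : n <> Some 0%N -> 0 <= lower_diam X n alpha.
Proof.
(* Index 1 is present, so each supremum of diameters is nonnegative; over no indices it would be
   [-oo]. *)
move=> n0; have n1 : idx n 1%N by case: n n0 => [[|m]|].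
apply: le_ereal_inf_tmp => _ [Y _ ->]; apply: le_ereal_inf_tmp => _ [A _ <-].
apply: le_trans (diameter_ge0 _ _ (A 1%N)) _.
by apply: ereal_sup_ubound; exists 1%N.
Qed.

(** The singletons of the atoms form an admissible family in [Y], each of diameter 0. *)
Lemma lower_diam_atoms (R : realType) (Y X : mmSpace R) (n : option nat)
    (alpha : nat -> R) (y : nat -> Y) :
  dominates Y X -> set_inj (idx n) y ->
  (forall i, idx n i -> (alpha i)%:E <= mm_measure Y [set y i]) ->
  lower_diam X n alpha <= 0.
Proof.
move=> YX yinj ay; apply: (@le_trans _ _ (diam Y n alpha)).
  by apply: ereal_inf_lbound; exists Y.
apply: (@le_trans _ _ (ereal_sup [set diameter [set y i] | i in idx n])).
  apply: ereal_inf_lbound; exists (fun i => [set y i]) => //; split => //.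
    by move=> i _; exact: measurable_set1_borel.
  by move=> i j ni nj [z [/= -> /yinj]]; rewrite !inE => /(_ ni nj).
apply: ge_ereal_sup => _ [i _ <-].
apply: ge_ereal_sup => _ [->//|[p [-> ->] <-]].
by rewrite mdistxx.
Qed.

Theorem theorem1p2 (R : realType) (X : mmSpace R) (n : option nat)
    (n_gt0 : n <> Some 0%N) (alpha : nat -> R)
    (alpha_gt0 : forall i, idx n i -> (0 < alpha i)%R) :
  [<->
    exists2 Y : mmSpace R, dominates Y X &
      exists2 y : nat -> Y, set_inj (idx n) y &
        forall i, idx n i -> (alpha i)%:E <= mm_measure Y [set y i];
    exists x : nat -> X, forall I : set nat, I `<=` idx n ->
      \esum_(i in I) (alpha i)%:E <= mm_measure X [set x i | i in I];
    lower_diam X n alpha = 0;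
    lower_ObsDiam X n alpha = 0].
Proof.
tfae.
(* (1) implies (2): [F] may identify some atoms, but the preimage of their images still contains all
   the distinct [y i]. *)
- move=> [Y [F Flip Fmu] [y yinj ay]]; exists (F \o y) => I In.
  have mI (T : completeMetricType R) (z : nat -> T) (J : set nat) :
      measurable ([set z i | i in J] : set (borelType T)).
    rewrite -bigcup_imset1; apply: bigcup_measurable => i _.
    exact: measurable_set1_borel.
  rewrite -Fmu; last exact: mI.
  apply: (@le_trans _ _ (mm_measure Y [set y i | i in I])).
    rewrite -bigcup_imset1 measure_bigcup.
    + rewrite nneseries_esum// set_mem_set.
      by apply: le_esum => i Ii; exact/ay/In.
    + by move=> i _; exact: measurable_set1_borel.
    + move=> i j Ii Ij [z [/= -> /yinj]]; rewrite !inE => -> //; exact: In.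
  apply: le_measure; rewrite ?inE.
  + exact: mI.
  + by rewrite -[X in measurable X]setTI; apply: (lipschitz1_measurable Flip).
  + by move=> _ [i Ii <-]; exists i.
(* (2) implies (3) by way of (1). *)
- move=> [x /(atoms_dominating _ _ _ _ _ alpha_gt0)[Y YX [y yinj ay]]].
  apply/eqP; rewrite eq_le lower_diam_ge0// andbT.
  exact: (lower_diam_atoms _ _ _ _ _ _ YX yinj ay).
- move=> d0; apply/eqP; rewrite eq_le; apply/andP; split.
    apply: ge_ereal_sup => _ [f [lf ->]]; rewrite -d0.
    exact/lower_diam_le/dominates_line.
  (* Any single 1-Lipschitz function bounds the supremum from below by 0. *)
  have lf : lipschitz1 (mdist (point : X) : X -> R^o) := lipschitz1_mdist _ _ _.
  apply: le_trans (lower_diam_ge0 _ (mm_line lf) _ alpha n_gt0) _.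
  by apply: ereal_sup_ubound; exists (mdist (point : X)), lf.
(* (4) implies (1) by way of (2). *)
- move=> obs0.
  have [|x ax] := @lower_ObsDiam0_atoms _ X _ _ alpha_gt0.
    by rewrite obs0.
  exact: atoms_dominating ax.
Qed.
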